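(* Let $G$ be a finite simple connected graph with at least one edge, with maximum degree $\Delta$ and minimum degree $\delta$, and let $\alpha\in\mathbb{R}\setminus\{0\}$. Then the following statements hold. (a) If $\alpha\le 1/2$, then $\delta^{-2\alpha+1}\Delta^{-1}R_\alpha(G)\le GA_1(G)\le \Delta^{-2\alpha+1}\delta^{-1}R_\alpha(G)$. (b) If $\alpha\ge 1/2$, then $\Delta^{-2\alpha}R_\alpha(G)\le GA_1(G)\le \delta^{-2\alpha}R_\alpha(G)$. Furthermore, each of these equalities holds if and only if $G$ is a regular graph.
   Context: For a graph $G$ with vertex set $V(G)$ and edge set $E(G)$, $d_u$ denotes the degree of the vertex $u$. The first geometric-arithmetic index is $GA_1(G)=\sum_{uv\in E(G)}\frac{2\sqrt{d_ud_v}}{d_u+d_v}$. For $\alpha\in\mathbb{R}\setminus\{0\}$ the general Randić index is $R_\alpha(G)=\sum_{uv\in E(G)}(d_ud_v)^\alpha$. *)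

(* Defs.v *)
From HB Require Import structures.
From mathcomp Require Import all_boot all_order all_algebra.
From mathcomp Require Import reals exp.

Set Implicit Arguments.
Unset Strict Implicit.
Unset Printing Implicit Defensive.

Import Order.TTheory GRing.Theory Num.Theory.

Local Open Scope ring_scope.

Record sgraph (T : finType) := SGraph {
  adj :> rel T;
  adj_sym : symmetric adj;
  adj_irr : irreflexive adj
}.

Section Graph.
Variables (T : finType) (G : sgraph T).

Definition edges : {set {set T}} :=
  [set [set p.1; p.2] | p : T * T & G p.1 p.2].

Definition deg (u : T) : nat := #|[set v | G u v]|.

Definition maxdeg : nat := (\max_(v : T) deg v)%N.

(* The default value #|T| is larger than every degree, so it is only the value
   of the minimum when there are no vertices. *)
Definition mindeg : nat := \big[minn/#|T|]_(v : T) deg v.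

Definition connected_graph : Prop := forall u v : T, connect G u v.

Definition regular_graph : Prop := exists k : nat, forall v : T, deg v = k.

(* An edge is a two-element set f = {u, v}, so the product and the sum of the
   degrees over f are d_u d_v and d_u + d_v (edge_deg_prod, edge_deg_sum). *)
Definition edge_prod (f : {set T}) : nat := (\prod_(u in f) deg u)%N.
Definition edge_sum (f : {set T}) : nat := (\sum_(u in f) deg u)%N.

Definition GA1 (R : realType) : R :=
  \sum_(f in edges) 2 * Num.sqrt (edge_prod f)%:R / (edge_sum f)%:R.

Definition randic (R : realType) (alpha : R) : R :=
  \sum_(f in edges) (edge_prod f)%:R `^ alpha.

Lemma edge_deg_prod u v : G u v -> edge_prod [set u; v] = (deg u * deg v)%N.
Proof.
move=> uv; have Nuv : u != v.
  by apply/eqP => uE; move: uv; rewrite uE adj_irr.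
by rewrite /edge_prod big_setU1 ?in_set1 //= big_set1.
Qed.

Lemma edge_deg_sum u v : G u v -> edge_sum [set u; v] = (deg u + deg v)%N.
Proof.
move=> uv; have Nuv : u != v.
  by apply/eqP => uE; move: uv; rewrite uE adj_irr.
by rewrite /edge_sum big_setU1 ?in_set1 //= big_set1.
Qed.

Lemma mem_edges u v : ([set u; v] \in edges) = G u v.
Proof.
apply/imsetP/idP => [[[a b]]|uv]; last by exists (u, v); rewrite ?inE.
rewrite inE /= => ab /setP E.
have Nab : a != b by apply/eqP => aE; move: ab; rewrite aE adj_irr.
move: (E a) (E b) (E u) (E v); rewrite !inE !eqxx ?orbT /=.
move=> /orP[]/eqP ? /orP[]/eqP ?; subst => //; rewrite ?eqxx in Nab => //.
by rewrite adj_sym.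
Qed.

End Graph.

(* Main.v *)
(** For an edge uv put p = d_u d_v and s = d_u + d_v.  The ratio of its
    contributions to GA_1 and R_alpha is p^(1/2 - alpha) * (2 / s).  The first
    factor is monotone in p, which lies in [delta^2, Delta^2], and the second
    lies in [1 / Delta, 1 / delta]; the sign of 1/2 - alpha decides which end of
    the interval bounds the first factor.  Equality forces the second factor to
    be extremal on every edge, i.e. d_u = d_v = Delta (resp. delta), and every
    vertex lies on an edge. *)
Require Import Defs.
From HB Require Import structures.
From mathcomp Require Import all_boot all_order all_algebra.
From mathcomp Require Import reals exp.
From mathcomp Require Import zify ring.

Set Implicit Arguments.
Unset Strict Implicit.
Unset Printing Implicit Defensive.

Import Order.TTheory GRing.Theory Num.Theory.
Local Open Scope ring_scope.

(** * Degree bounds on vertices and edges *)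

Section Degrees.
Variables (T : finType) (G : sgraph T).

Lemma edgesP (f : {set T}) :
  f \in edges G -> exists u v, G u v /\ f = [set u; v].
Proof. by case/imsetP => [[u v]]; rewrite inE /= => uv ->; exists u, v. Qed.

Lemma leq_deg_maxdeg (v : T) : (deg G v <= maxdeg G)%N.
Proof. exact: (leq_bigmax_cond (P := xpredT)). Qed.

Lemma leq_mindeg_deg (v : T) : (mindeg G <= deg G v)%N.
Proof.
(* The default [#|T|] is not a unit for [minn] on all of [nat], so [v] is tracked through the fold
   by induction on the enumeration of vertices. *)
rewrite /mindeg -big_filter filter_predT.
have: v \in index_enum T by rewrite mem_index_enum.
elim: (index_enum T) => //= w s IH; rewrite inE big_cons geq_min.
by case/predU1P => [->|/IH ->]; rewrite ?leqnn ?orbT.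
Qed.

(** The fold starts from [#|T|], so a lower bound must hold for that value as well as for every
    degree. *)
Lemma leq_mindeg (k : nat) :
  (k <= #|T|)%N -> (forall v, (k <= deg G v)%N) -> (k <= mindeg G)%N.
Proof.
move=> kT kdeg; rewrite /mindeg; elim/big_ind: _ => // x y kx ky.
by rewrite leq_min kx.
Qed.

Lemma connected_has_neighbor (u : T) :
  connected_graph G -> edges G != set0 -> exists v, G u v.
Proof.
move=> conn /set0Pn[f /edgesP[a [b [ab _]]]].
(* Follow a path from [u] to an endpoint [a] of some edge: if it is empty then [u] is [a], with
   neighbor [b]; otherwise its first step is a neighbor. *)
case/connectP: (conn u a) => [[|v s] /=]; first by move=> _ <-; exists b.
by case/andP => uv _ _; exists v.
Qed.

Hypotheses (conn : connected_graph G) (Gedge : edges G != set0).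

Lemma mindeg_gt0 : (0 < mindeg G)%N.
Proof.
apply: leq_mindeg => [|v].
  by have /set0Pn[f /edgesP[a _]] := Gedge; apply/card_gt0P; exists a.
have [w vw] := connected_has_neighbor v conn Gedge.
by apply/card_gt0P; exists w; rewrite inE.
Qed.

Lemma deg_gt0 (v : T) : (0 < deg G v)%N.
Proof. exact: leq_trans mindeg_gt0 (leq_mindeg_deg v). Qed.

Lemma maxdeg_gt0 : (0 < maxdeg G)%N.
Proof.
have /set0Pn[f /edgesP[a _]] := Gedge.
exact: leq_trans (deg_gt0 a) (leq_deg_maxdeg a).
Qed.

Lemma regular_mindeg (k : nat) : (forall v, deg G v = k) -> mindeg G = k.
Proof.
move=> degk; have /set0Pn[f /edgesP[a _]] := Gedge.
apply/eqP; rewrite eqn_leq -{1}(degk a) leq_mindeg_deg leq_mindeg //.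
  by rewrite -(degk a) max_card.
by move=> v; rewrite degk.
Qed.

Lemma regular_maxdeg (k : nat) : (forall v, deg G v = k) -> maxdeg G = k.
Proof.
move=> degk; have /set0Pn[f /edgesP[a _]] := Gedge.
apply/eqP; rewrite eqn_leq -{2}(degk a) leq_deg_maxdeg andbT.
by apply/bigmax_leqP => v _; rewrite degk.
Qed.

Lemma edge_prod_bounds (f : {set T}) : f \in edges G ->
  (mindeg G ^ 2 <= edge_prod G f <= maxdeg G ^ 2)%N.
Proof.
case/edgesP=> [u [v [uv ->]]]; rewrite edge_deg_prod // -!mulnn.
by rewrite !leq_mul ?leq_mindeg_deg ?leq_deg_maxdeg.
Qed.

Lemma edge_sum_bounds (f : {set T}) : f \in edges G ->
  (2 * mindeg G <= edge_sum G f <= 2 * maxdeg G)%N.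
Proof.
case/edgesP=> [u [v [uv ->]]]; rewrite edge_deg_sum // !mul2n -!addnn.
by rewrite !leq_add ?leq_mindeg_deg ?leq_deg_maxdeg.
Qed.

Lemma edge_prod_gt0 (f : {set T}) : f \in edges G -> (0 < edge_prod G f)%N.
Proof.
case/edge_prod_bounds/andP => le_p _; apply: leq_trans le_p.
by rewrite expn_gt0 mindeg_gt0.
Qed.

Lemma edge_sum_gt0 (f : {set T}) : f \in edges G -> (0 < edge_sum G f)%N.
Proof.
case/edge_sum_bounds/andP => le_s _; apply: leq_trans le_s.
by rewrite muln_gt0 mindeg_gt0.
Qed.

(** Every vertex lies on an edge, and two degrees that are at most the maximum can add up to twice
    it only if both attain it. *)
Lemma edge_sum_max_regular :
  (forall f, f \in edges G -> edge_sum G f = 2 * maxdeg G)%N ->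
  regular_graph G.
Proof.
move=> sumE; exists (maxdeg G) => u.
have [v uv] := connected_has_neighbor u conn Gedge.
have := sumE [set u; v]; rewrite mem_edges edge_deg_sum // => /(_ uv).
by have := leq_deg_maxdeg u; have := leq_deg_maxdeg v; lia.
Qed.

Lemma edge_sum_min_regular :
  (forall f, f \in edges G -> edge_sum G f = 2 * mindeg G)%N ->
  regular_graph G.
Proof.
move=> sumE; exists (mindeg G) => u.
have [v uv] := connected_has_neighbor u conn Gedge.
have := sumE [set u; v]; rewrite mem_edges edge_deg_sum // => /(_ uv).
by have := leq_mindeg_deg u; have := leq_mindeg_deg v; lia.
Qed.

End Degrees.

(** * Auxiliary facts on products and real powers *)

Lemma eq_mul_le (R : realFieldType) (a a' b b' : R) :
  0 < a -> 0 < b -> a <= a' -> b <= b' -> a * b = a' * b' -> b = b'.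
Proof.
move=> a0 b0 aa' bb' E; apply/eqP; rewrite eq_le bb' /=.
(* Here [a * b' <= a' * b' = a * b], and the positive [a] cancels. *)
by rewrite -(ler_pM2l a0) E ler_wpM2r // (le_trans _ bb') // ltW.
Qed.

Lemma powR_sqr_half (R : realType) (x r : R) :
  0 <= x -> (x ^+ 2) `^ (1 / 2 - r) = x `^ (- 2 * r + 1).
Proof.
by move=> x0; rewrite -powR_mulrn // -powRrM; congr (_ `^ _); field.
Qed.

(** * Edgewise comparison of the two indices *)

Section Ratio.
Variables (R : realType) (T : finType) (G : sgraph T) (alpha : R).
Hypotheses (conn : connected_graph G) (Gedge : edges G != set0).

Let p (f : {set T}) : R := (edge_prod G f)%:R.
Let s (f : {set T}) : R := (edge_sum G f)%:R.
Let Delta : R := (maxdeg G)%:R.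
Let delta : R := (mindeg G)%:R.

Lemma GA1_ratio : GA1 G R =
  \sum_(f in edges G) (p f `^ (1 / 2 - alpha) * (2 / s f)) * p f `^ alpha.
Proof.
apply: eq_bigr => f fE; have p0 : p f != 0.
  by rewrite pnatr_eq0 -lt0n edge_prod_gt0.
(* The exponents [1 / 2 - alpha] and [alpha] add up to [1 / 2], which leaves the square root of
   [p f]. *)
rewrite [RHS]mulrAC -powRD ?p0 ?implybT // subrK mul1r.
by rewrite powR12_sqrt ?ler0n // mulrA (mulrC _ 2).
Qed.

(** Leaving [L] open serves both ranges of [alpha]: it will be [delta] below 1/2 and [Delta] above.
    The last hypothesis identifies [L] with the common degree in the regular case. *)
Lemma GA1_ge_randic (L : R) : 0 < L ->
  (forall f, f \in edges G -> (L ^+ 2) `^ (1 / 2 - alpha)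
                              <= p f `^ (1 / 2 - alpha)) ->
  (forall k, (forall v, deg G v = k) -> L = k%:R) ->
  L `^ (- 2 * alpha + 1) * Delta^-1 * randic G alpha <= GA1 G R /\
  (L `^ (- 2 * alpha + 1) * Delta^-1 * randic G alpha = GA1 G R
     <-> regular_graph G).
Proof.
move=> L0 Lp Lreg; rewrite -powR_sqr_half ?(ltW L0) // GA1_ratio mulr_sumr.
set c := _ `^ _ in Lp *.
have c0 : 0 < c by rewrite powR_gt0 // exprn_gt0.
have D0 : 0 < Delta by rewrite ltr0n maxdeg_gt0.
have sD f : f \in edges G -> Delta^-1 <= 2 / s f.
  move=> fE; have s0 : 0 < s f by rewrite ltr0n edge_sum_gt0.
  rewrite ler_pdivlMr // mulrC ler_pdivrMr // -natrM ler_nat.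
  by case/andP: (edge_sum_bounds fE).
(* Each termwise bound carries its equality condition, so that equality of the sums becomes equality
   on every edge. *)
have term f : f \in edges G ->
    c * Delta^-1 * p f `^ alpha <=
      p f `^ (1 / 2 - alpha) * (2 / s f) * p f `^ alpha
      ?= iff (c * Delta^-1 == p f `^ (1 / 2 - alpha) * (2 / s f)).
  move=> fE; have pa0 : 0 < p f `^ alpha.
    by rewrite powR_gt0 // ltr0n edge_prod_gt0.
  split; last by rewrite (inj_eq (mulIf _)) // gt_eqF.
  apply: ler_wpM2r; first exact: ltW.
  by apply: ler_pM; rewrite ?sD ?Lp // ltW // invr_gt0.
have [le_sum eq_sum] := leif_sum term; split=> //; split.
  move/eqP; rewrite eq_sum => /forall_inP eqs.
  apply: edge_sum_max_regular => // f fE.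
  (* Both factors are bounded separately, so equal products force [Delta^-1 = 2 / s f]. *)
  have /eqP /eq_mul_le := eqs f fE.
  rewrite c0 invr_gt0 D0 Lp ?sD // => /(_ isT isT isT isT) sE.
  have s0 : s f != 0 by rewrite pnatr_eq0 -lt0n edge_sum_gt0.
  apply/eqP; rewrite -(eqr_nat R) natrM -/(s f) -/Delta.
  have -> : 2 = Delta^-1 * s f by rewrite sE divfK.
  by rewrite mulrAC mulVf ?mul1r // gt_eqF.
case=> k degk; apply/eqP; rewrite eq_sum; apply/forall_inP => f fE.
(* In a [k]-regular graph every edge has product [k ^ 2] and sum [2 * k], so both sides coincide. *)
have k0 : k%:R != 0 :> R by rewrite -(Lreg k) // gt_eqF.
rewrite /c /Delta /p /s (Lreg k) // (regular_maxdeg Gedge degk).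
have [u [v [uv ->]]] := edgesP fE.
rewrite edge_deg_prod // edge_deg_sum // !degk natrM natrD -expr2.
by rewrite -mulr2n -[k%:R *+ 2]mulr_natl invfM mulVKf ?pnatr_eq0.
Qed.

(** The mirror image: [U] will be [Delta] for [alpha] below 1/2 and [delta] above, and equality
    makes every edge sum minimal. *)
Lemma GA1_le_randic (U : R) : 0 < U ->
  (forall f, f \in edges G -> p f `^ (1 / 2 - alpha)
                              <= (U ^+ 2) `^ (1 / 2 - alpha)) ->
  (forall k, (forall v, deg G v = k) -> U = k%:R) ->
  GA1 G R <= U `^ (- 2 * alpha + 1) * delta^-1 * randic G alpha /\
  (GA1 G R = U `^ (- 2 * alpha + 1) * delta^-1 * randic G alpha
     <-> regular_graph G).
Proof.
move=> U0 pU Ureg; rewrite -powR_sqr_half ?(ltW U0) // GA1_ratio mulr_sumr.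
set c := _ `^ _ in pU *.
have d0 : 0 < delta by rewrite ltr0n mindeg_gt0.
have s0 f : f \in edges G -> 0 < 2 / s f.
  by move=> fE; rewrite divr_gt0 // ltr0n edge_sum_gt0.
have pb0 f (r : R) : f \in edges G -> 0 < p f `^ r.
  by move=> fE; rewrite powR_gt0 // ltr0n edge_prod_gt0.
have sd f : f \in edges G -> 2 / s f <= delta^-1.
  move=> fE; have sf0 : 0 < s f by rewrite ltr0n edge_sum_gt0.
  rewrite ler_pdivrMr // ler_pdivlMl // mulrC -natrM ler_nat.
  by case/andP: (edge_sum_bounds fE).
have term f : f \in edges G ->
    p f `^ (1 / 2 - alpha) * (2 / s f) * p f `^ alpha <=
      c * delta^-1 * p f `^ alpha
      ?= iff (p f `^ (1 / 2 - alpha) * (2 / s f) == c * delta^-1).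
  move=> fE; split; last by rewrite (inj_eq (mulIf _)) // gt_eqF ?pb0.
  apply: ler_wpM2r; first exact/ltW/pb0.
  by apply: ler_pM; rewrite ?sd ?pU // ltW ?pb0 ?s0.
have [le_sum eq_sum] := leif_sum term; split=> //; split.
  move/eqP; rewrite eq_sum => /forall_inP eqs.
  apply: edge_sum_min_regular => // f fE.
  have /eqP /eq_mul_le := eqs f fE.
  rewrite pb0 // s0 // pU // sd // => /(_ isT isT isT isT) sE.
  have sf0 : s f != 0 by rewrite pnatr_eq0 -lt0n edge_sum_gt0.
  apply/eqP; rewrite -(eqr_nat R) natrM -/(s f) -/delta.
  have -> : 2 = delta^-1 * s f by rewrite -sE divfK.
  by rewrite mulrAC mulVf ?mul1r // gt_eqF.
case=> k degk; apply/eqP; rewrite eq_sum; apply/forall_inP => f fE.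
have k0 : k%:R != 0 :> R by rewrite -(Ureg k) // gt_eqF.
rewrite /c /delta /p /s (Ureg k) // (regular_mindeg Gedge degk).
have [u [v [uv ->]]] := edgesP fE.
rewrite edge_deg_prod // edge_deg_sum // !degk natrM natrD -expr2.
by rewrite -mulr2n -[k%:R *+ 2]mulr_natl invfM mulVKf ?pnatr_eq0.
Qed.

End Ratio.

Lemma ler_powR_neg (R : realType) (r x y : R) :
  r <= 0 -> 0 < x -> x <= y -> y `^ r <= x `^ r.
Proof.
move=> r0 x0 xy; have y0 := lt_le_trans x0 xy.
(* Inversion reverses the order and reduces to the nonnegative exponent [- r]. *)
rewrite -(opprK r) !(powRN _ (- r)) lef_pV2 ?posrE ?powR_gt0 //.
by rewrite ge0_ler_powR ?nnegrE ?oppr_ge0 // ltW.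
Qed.

Theorem theorem2p9 (R : realType) (T : finType) (G : sgraph T) (alpha : R)
    (Gconn : connected_graph G) (Gedge : edges G != set0)
    (alpha_neq0 : alpha != 0) :
  let Delta : R := (maxdeg G)%:R in
  let delta : R := (mindeg G)%:R in
  let GA : R := GA1 G R in
  let Ra : R := randic G alpha in
  (alpha <= 1 / 2 ->
    [/\ delta `^ (- 2 * alpha + 1) * Delta^-1 * Ra <= GA,
        GA <= Delta `^ (- 2 * alpha + 1) * delta^-1 * Ra,
        delta `^ (- 2 * alpha + 1) * Delta^-1 * Ra = GA <-> regular_graph G
      & GA = Delta `^ (- 2 * alpha + 1) * delta^-1 * Ra <-> regular_graph G])
  /\
  (1 / 2 <= alpha ->
    [/\ Delta `^ (- 2 * alpha) * Ra <= GA,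
        GA <= delta `^ (- 2 * alpha) * Ra,
        Delta `^ (- 2 * alpha) * Ra = GA <-> regular_graph G
      & GA = delta `^ (- 2 * alpha) * Ra <-> regular_graph G]).
Proof.
move=> Delta delta GA Ra.
have D0 : 0 < Delta by rewrite ltr0n maxdeg_gt0.
have d0 : 0 < delta by rewrite ltr0n mindeg_gt0.
have Dreg k : (forall v, deg G v = k) -> Delta = k%:R.
  by move=> degk; rewrite /Delta (regular_maxdeg Gedge degk).
have dreg k : (forall v, deg G v = k) -> delta = k%:R.
  by move=> degk; rewrite /delta (regular_mindeg Gedge degk).
have p0 f : f \in edges G -> 0 < (edge_prod G f)%:R :> R.
  by move=> fE; rewrite ltr0n edge_prod_gt0.
have dp f : f \in edges G -> delta ^+ 2 <= (edge_prod G f)%:R.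
  by case/edge_prod_bounds/andP => dp _; rewrite -natrX ler_nat.
have pD f : f \in edges G -> (edge_prod G f)%:R <= Delta ^+ 2.
  by case/edge_prod_bounds/andP => _ pD; rewrite -natrX ler_nat.
(* In the second range the open bound and the degree being divided by are the same number, so the
   two factors merge into one power. *)
have powR_div (x : R) : 0 < x ->
    x `^ (- 2 * alpha) = x `^ (- 2 * alpha + 1) / x.
  move=> x0; have xN0 : x != 0 by rewrite gt_eqF.
  by rewrite powRD ?xN0 ?implybT // powRr1 ?mulfK ?(ltW x0).
split=> [ale|age].
  have r0 : 0 <= 1 / 2 - alpha by rewrite subr_ge0.
  have [|lo loE] := GA1_ge_randic (alpha := alpha) Gconn Gedge d0 _ dreg.
    by move=> f fE; rewrite ge0_ler_powR ?nnegrE ?exprn_ge0 ?dp // ltW // p0.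
  have [|up upE] := GA1_le_randic (alpha := alpha) Gconn Gedge D0 _ Dreg.
    by move=> f fE; rewrite ge0_ler_powR ?nnegrE ?exprn_ge0 ?pD // ltW // p0.
  by [].
(* The power of the edge product is now decreasing, so [Delta] and [delta] swap roles in it. *)
have r0 : 1 / 2 - alpha <= 0 by rewrite subr_le0.
rewrite !powR_div //.
have [|lo loE] := GA1_ge_randic (alpha := alpha) Gconn Gedge D0 _ Dreg.
  by move=> f fE; rewrite ler_powR_neg ?pD ?p0.
have [|up upE] := GA1_le_randic (alpha := alpha) Gconn Gedge d0 _ dreg.
  by move=> f fE; rewrite ler_powR_neg ?dp ?exprn_gt0.
by [].
Qed.
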